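(* A $2n$-dimensional Hermitian strongly unimodular almost nilpotent Lie algebra $(\mu(0,0,A,\eta),J,g)$ is never Kähler, and it is SKT if and only if $A\in\mathfrak{u}(\mathfrak{k}_1,J|_{\mathfrak{k}_1},g)$ and $\eta^2=0$ (the latter being equivalent to the nilradical $\mathfrak{n}$ being isomorphic to $\mathfrak{h}_3\oplus\mathbb{R}^{2(n-2)}$).
   Context: On $\mathbb{R}^{2n}$ ($n\geq 2$) with standard basis $\{e_1,\dots,e_{2n}\}$ let $g$ be the standard inner product, let $Je_1=e_{2n}$, $Je_{2l}=e_{2l+1}$ for $l=1,\dots,n-1$, and let $\mathfrak{k}_1=\mathbb{R}\langle e_2,\dots,e_{2n-1}\rangle$. For $A\in\mathfrak{gl}(\mathfrak{k}_1)$, $0\ne\eta\in\Lambda^2\mathfrak{k}_1^*$ with $\eta(AX,Y)+\eta(X,AY)=0$, $\mu(0,0,A,\eta)$ is the Lie algebra structure on $\mathbb{R}^{2n}$ with brackets $[e_{2n},e_1]=0$, $[e_{2n},X]=AX$, $[X,Y]=-\eta(X,Y)e_1$, $[e_1,X]=0$ for $X,Y\in\mathfrak{k}_1$. Hermitian means $J$ is integrable, which is equivalent to $[A,J|_{\mathfrak{k}_1}]=0$ and $\eta(J\cdot,J\cdot)=\eta$. It is almost nilpotent with nilradical $\mathfrak{n}=\mathbb{R}\langle e_1,\dots,e_{2n-1}\rangle$, $[\mathfrak{n},\mathfrak{n}]=\mathbb{R}e_1$, and strong unimodularity amounts here to $\operatorname{tr}A=0$. $\mathfrak{u}(\mathfrak{k}_1,J|_{\mathfrak{k}_1},g)$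 is the space of endomorphisms of $\mathfrak{k}_1$ commuting with $J$ and skew-symmetric with respect to $g$. $\omega=g(J\cdot,\cdot)$; $d$ is the Chevalley–Eilenberg differential, $d^c=i(\overline\partial-\partial)$; SKT means $dd^c\omega=0$, Kähler means $d\omega=0$; $\eta^2=\eta\wedge\eta$; $\mathfrak{h}_3$ is the 3-dimensional Heisenberg Lie algebra. *)

(* Defs.v *)
From HB Require Import structures.
From mathcomp Require Import all_boot all_order all_algebra all_fingroup.
From mathcomp Require Import reals.
From mathcomp.real_closed Require Import complex.

Set Implicit Arguments.
Unset Strict Implicit.
Unset Printing Implicit Defensive.

Import Order.TTheory GRing.Theory Num.Theory.

Local Open Scope ring_scope.
Local Open Scope complex_scope.

(* Lie algebras are vector spaces with an explicit bracket [br]; bilinearity,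
   skew-symmetry and the Jacobi identity are not bundled: they hold for [mu]
   below, thanks to the compatibility condition between A and eta. *)

Section LieAlgebra.
Variables (F : fieldType) (V : vectType F) (br : V -> V -> V).
Implicit Types U W I N : {vspace V}.

Definition ad (X : V) : 'End(V) := linfun (br X).

Definition brv U W : {vspace V} := <<[seq br u w | u <- vbasis U, w <- vbasis W]>>.

Definition lie_ideal I : Prop := forall X Y, Y \in I -> br X Y \in I.

(* N^0 = N, N^(k+1) = [N, N^k] *)
Fixpoint lcs N (k : nat) : {vspace V} :=
  if k is k'.+1 then brv N (lcs N k') else N.

Definition lie_nilpotent N : Prop := exists k, lcs N k = 0%VS.

Definition is_nilradical N : Prop :=
  [/\ lie_ideal N, lie_nilpotent N &
      forall I, lie_ideal I -> lie_nilpotent I -> (I <= N)%VS].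

Definition trace_on (f : 'End(V)) U : F :=
  \sum_(i < \dim U) coord (vbasis U) i (f (vbasis U)`_i).

(* The trace of the endomorphism induced by f on U / W, for W <= U both stable
   under f: U / W is identified with the complement U :\: W of W in U, and
   [addv_pi1 U W] is the projection of U onto it along W. *)
Definition trace_quo (f : 'End(V)) U W : F :=
  trace_on (addv_pi1 U W \o f)%VF (U :\: W).

Definition strongly_unimodular : Prop :=
  exists2 N, is_nilradical N &
    forall X k, trace_quo (ad X) (lcs N k) (lcs N k.+1) = 0.

(* The Lie algebra (W, brW) is isomorphic to the subalgebra N of (V, br). *)
Definition lie_iso_sub (W : vectType F) (brW : W -> W -> W) N : Prop :=
  exists f : 'Hom(W, V),
    [/\ lker f = 0%VS, limg f = N & forall X Y, f (brW X Y) = br (f X) (f Y)].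

End LieAlgebra.

(* A k-form on V with values in K is a function of k vectors; every form used
   below is built from multilinear alternating ones. *)
Definition form (V K : Type) (k : nat) := ('I_k -> V) -> K.

Definition form0 (V : Type) (K : nmodType) k (alpha : form V K k) : Prop :=
  forall X, alpha X = 0.

Section ChevalleyEilenberg.
Variables (V : Type) (br : V -> V -> V) (K : pzRingType).

(* The family [X_i, X_j], X_0, .., X_k with X_i and X_j (i < j) left out *)
Definition ce_args k (X : 'I_k.+1 -> V) (i j : 'I_k.+1) : 'I_k -> V :=
  fun l => if l == 0%N :> nat then br (X i) (X j)
           else X (inord (bump j (bump i l.-1))).

Definition ce_d k (alpha : form V K k) : form V K k.+1 :=
  fun X => \sum_(i < k.+1) \sum_(j < k.+1 | (i < j)%N)
             (-1) ^+ (i + j) * alpha (ce_args X i j).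

End ChevalleyEilenberg.

Definition wedge (V : Type) (K : fieldType) p q
    (alpha : form V K p) (beta : form V K q) : form V K (p + q) :=
  fun X => (p`! * q`!)%:R^-1 *
    \sum_(s : 'S_(p + q)) (-1) ^+ s *
      alpha (fun i => X (s (lshift q i))) * beta (fun j => X (s (rshift p j))).

Section Dolbeault.
Variables (R : rcfType) (V : Type) (br : V -> V -> V) (J : V -> V).

(* Complex forms are R[i]-valued forms on the real Lie algebra, and the
   (1,0)-forms are those with alpha (J X) = 'i * alpha X.  Each argument splits
   alpha as (alpha - 'i alpha(J _))/2 + (alpha + 'i alpha(J _))/2; the component
   of type (p, k - p) collects the terms where the first summand is chosen in
   exactly p arguments (the set S); T is the set of arguments J is applied to. *)
Definition type_part k (p : nat) (alpha : form V R[i] k) : form V R[i] k :=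
  fun X => \sum_(S : {set 'I_k} | #|S| == p) \sum_(T : {set 'I_k})
    (2 ^+ k)^-1 * (\prod_(l in T) (if l \in S then - 'i%C else 'i%C)) *
    alpha (fun l => if l \in T then J (X l) else X l).

Definition del k (alpha : form V R[i] k) : form V R[i] k.+1 :=
  fun X => \sum_(p < k.+1) type_part p.+1 (ce_d br (type_part p alpha)) X.

Definition delbar k (alpha : form V R[i] k) : form V R[i] k.+1 :=
  fun X => \sum_(p < k.+1) type_part p (ce_d br (type_part p alpha)) X.

Definition dc k (alpha : form V R[i] k) : form V R[i] k.+1 :=
  fun X => 'i%C * (delbar alpha X - del alpha X).

End Dolbeault.

Section Hermitian.
Variables (R : rcfType) (V : zmodType).
Variables (br : V -> V -> V) (J : V -> V) (g : V -> V -> R).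

Definition integrable : Prop := forall X Y,
  br (J X) (J Y) - J (br (J X) Y) - J (br X (J Y)) - br X Y = 0.

Definition fundamental_form : form V R 2 :=
  fun X => g (J (X ord0)) (X ord_max).

Definition kahler : Prop := form0 (ce_d br fundamental_form).

Definition skt : Prop :=
  form0 (ce_d br (dc br J (fun X => (fundamental_form X)%:C))).

End Hermitian.

(* k_1 is 'cV_m with m = 2n - 2, the index i standing for e_{i+2}, and R^{2n}
   is R e_1 + k_1 + R e_{2n}. *)
Notation kvec R m := ('cV[R]_m).
Notation gvec R m := ('cV[R]_(1 + m + 1)).

Section Mu.
Variables (R : realType) (m : nat).

Definition inner d (X Y : 'cV[R]_d) : R := (X^T *m Y) 0 0.

Definition gvec_of (x : R) (X : kvec R m) (y : R) : gvec R m :=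
  col_mx (col_mx x%:M X) y%:M.
Definition coord_first (v : gvec R m) : R := usubmx (usubmx v) 0 0.
Definition coord_k1 (v : gvec R m) : kvec R m := dsubmx (usubmx v).
Definition coord_last (v : gvec R m) : R := dsubmx v 0 0.

(* J e_{2l} = e_{2l+1} and J e_{2l+1} = - e_{2l}; the index of e_{2l} is even. *)
Definition Jk1_mx : 'M[R]_m :=
  \matrix_(i, j) ((~~ odd j && (i == j.+1 :> nat))%:R
                  - (~~ odd i && (j == i.+1 :> nat))%:R).
Definition Jk1 (X : kvec R m) : kvec R m := Jk1_mx *m X.

Definition Jg (v : gvec R m) : gvec R m :=
  gvec_of (- coord_last v) (Jk1 (coord_k1 v)) (coord_first v).

(* An element of Lambda^2 k_1^* is given by its skew-symmetric matrix. *)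
Definition form_mx (eta : 'M[R]_m) (X Y : kvec R m) : R := (X^T *m eta *m Y) 0 0.
Definition form2_mx (eta : 'M[R]_m) : form (kvec R m) R 2 :=
  fun X => form_mx eta (X ord0) (X ord_max).

Definition mu (A eta : 'M[R]_m) (u v : gvec R m) : gvec R m :=
  gvec_of (- form_mx eta (coord_k1 u) (coord_k1 v))
          (coord_last u *: (A *m coord_k1 v) - coord_last v *: (A *m coord_k1 u))
          0.

(* R<e_1, .., e_{2n-1}> *)
Definition nil_ideal : {vspace gvec R m} :=
  <<[seq delta_mx (lshift 1 i) 0 | i : 'I_(1 + m)]>>.

Definition in_u_k1 (A : 'M[R]_m) : Prop :=
  (forall X, A *m Jk1 X = Jk1 (A *m X)) /\
  (forall X Y, inner (A *m X) Y = - inner X (A *m Y)).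

End Mu.

Definition h3_br (R : realType) (u v : 'cV[R]_3) : 'cV[R]_3 :=
  (u 0 0 * v 1 0 - u 1 0 * v 0 0) *: delta_mx ord_max 0.

(* h_3 + R^k, as a direct sum of Lie algebras with R^k abelian *)
Definition h3_sum_br (R : realType) k (u v : 'cV[R]_(3 + k)) : 'cV[R]_(3 + k) :=
  col_mx (h3_br (usubmx u) (usubmx v)) 0.

(* Main.v *)
Require Import Defs.
From mathcomp Require Import all_boot all_order all_algebra all_fingroup.
From mathcomp Require Import reals boolp.
From mathcomp.real_closed Require Import complex.
From mathcomp Require Import ring lra zify.
Import GRing.Theory Num.Theory.
Local Open Scope ring_scope.

(* Put K = eta + J (A + A^T) and kappa(Y, Z) = Y^T K Z on k_1, and write e^1 and
   e^{2n} for the dual covectors.  Then d omega = e^{2n} /\ kappa and, kappa being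
   J-invariant, d^c omega = - e^1 /\ kappa.
   The e^{2n} /\ e^1 part of d d^c omega is A . kappa; as A . eta = 0, its
   vanishing reads A^T S + S A = 0 for S = A + A^T.  Taking traces,
   tr(S^2) = 0, so S = 0, i.e. A is skew.  Then K = eta and what is left of
   d d^c omega is eta /\ eta.  If d omega = 0, then kappa = 0, so again S = 0,
   whence eta = K = 0.
   Finally eta /\ eta = 0 and eta(a, b) = 1 give
   eta = eta(a, .) /\ eta(b, .), and a, b, - e_1 and a basis of the kernel of eta
   identify h_3 + R^{2(n-2)} with the nilradical. *)

(** * Bilinear forms given by matrices *)

Section Bilinear.
Variables (R : realType) (m : nat).
Implicit Types (M N : 'M[R]_m) (X Y Z : 'cV[R]_m).

Lemma form_mxDl M X Y Z : form_mx M (X + Y) Z = form_mx M X Z + form_mx M Y Z.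
Proof. by rewrite /form_mx linearD /= !mulmxDl mxE. Qed.
Lemma form_mxDr M X Y Z : form_mx M X (Y + Z) = form_mx M X Y + form_mx M X Z.
Proof. by rewrite /form_mx mulmxDr mxE. Qed.
Lemma form_mxZl M a X Y : form_mx M (a *: X) Y = a * form_mx M X Y.
Proof. by rewrite /form_mx linearZ /= -!scalemxAl mxE. Qed.
Lemma form_mxZr M a X Y : form_mx M X (a *: Y) = a * form_mx M X Y.
Proof. by rewrite /form_mx -scalemxAr mxE. Qed.
Lemma form_mxNl M X Y : form_mx M (- X) Y = - form_mx M X Y.
Proof. by rewrite -scaleN1r form_mxZl mulN1r. Qed.
Lemma form_mxNr M X Y : form_mx M X (- Y) = - form_mx M X Y.
Proof. by rewrite -scaleN1r form_mxZr mulN1r. Qed.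
Lemma form_mx0l M Y : form_mx M 0 Y = 0.
Proof. by rewrite -(scale0r 0) form_mxZl mul0r. Qed.
Lemma form_mx0r M X : form_mx M X 0 = 0.
Proof. by rewrite -(scale0r 0) form_mxZr mul0r. Qed.
Lemma form_mxD M N X Y : form_mx (M + N) X Y = form_mx M X Y + form_mx N X Y.
Proof. by rewrite /form_mx mulmxDr mulmxDl mxE. Qed.
Lemma form_mxN M X Y : form_mx (- M) X Y = - form_mx M X Y.
Proof. by rewrite /form_mx mulmxN mulNmx mxE. Qed.
Lemma form_0mx X Y : form_mx (0 : 'M_m) X Y = 0.
Proof. by rewrite /form_mx mulmx0 mul0mx mxE. Qed.
Lemma form_mxMl M N X Y : form_mx M (N *m X) Y = form_mx (N^T *m M) X Y.
Proof. by rewrite /form_mx trmx_mul !mulmxA. Qed.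
Lemma form_mxMr M N X Y : form_mx M X (N *m Y) = form_mx (M *m N) X Y.
Proof. by rewrite /form_mx !mulmxA. Qed.
Lemma form_mx_tr M X Y : form_mx M^T X Y = form_mx M Y X.
Proof.
have tr11 (C : 'M[R]_1) : C 0 0 = C^T 0 0 by rewrite mxE.
by rewrite /form_mx tr11 !trmx_mul !trmxK mulmxA.
Qed.
Lemma form_mx_skew M : M^T = - M -> forall X Y, form_mx M X Y = - form_mx M Y X.
Proof. by move=> M_skew X Y; rewrite -form_mx_tr M_skew form_mxN. Qed.
Lemma form_mx_inj M N : (forall X Y, form_mx M X Y = form_mx N X Y) -> M = N.
Proof.
move=> eqMN; apply/matrixP => i j; move: (eqMN (delta_mx i 0) (delta_mx j 0)).
by rewrite /form_mx !trmx_delta -!rowE -!colE !mxE.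
Qed.
Lemma inner_form_mx X Y : inner X Y = form_mx 1%:M X Y.
Proof. by rewrite /form_mx mulmx1. Qed.

(** For symmetric [S] this trace is the sum of the squares of all entries, so over the reals each
    entry must vanish. *)
Lemma sym_mx_eq0 (S : 'M[R]_m) : S^T = S -> \tr (S *m S) = 0 -> S = 0.
Proof.
move=> S_sym trS0; apply/matrixP => i j; rewrite mxE; apply/eqP.
have Sge0 k l : 0 <= S k l * S l k by rewrite -{2}S_sym mxE -expr2 sqr_ge0.
move/eqP: trS0; rewrite psumr_eq0 => [/allP/(_ i (mem_index_enum _))|k _].
  rewrite mxE psumr_eq0 // => /allP/(_ j (mem_index_enum _)) /=.
  by rewrite -{2}S_sym mxE mulf_eq0 orbb.
by rewrite mxE; apply: sumr_ge0.
Qed.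

End Bilinear.

(** * The complex structure on k_1 *)

Section ComplexStructure.
Variable R : realType.

Lemma tr_Jk1_mx m : (Jk1_mx R m)^T = - Jk1_mx R m.
Proof. by apply/matrixP => i j; rewrite !mxE opprB. Qed.

(** As the size is even, every index has a partner: row i has a single nonzero entry, in column i -
    1 for odd i and i + 1 for even i, and only that term of the product survives. *)
Lemma Jk1_mx_sqr p : Jk1_mx R p.*2 *m Jk1_mx R p.*2 = - 1%:M.
Proof.
apply/matrixP => i k; rewrite !mxE.
have [i_odd|i_even] := boolP (odd i).
  have i1 : (i.-1 < p.*2)%N by have := ltn_ord i; lia.
  rewrite (bigD1 (Ordinal i1)) //= big1 => [|j]; rewrite !mxE /= ?i_odd /=.
    rewrite (_ : odd i.-1 = false); last lia.
    have -> : (nat_of_ord i == i.-1.+1) = true by lia.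
    have -> : (~~ odd k && (i.-1 == k.+1)) = false by lia.
    have -> : (nat_of_ord k == i.-1.+1) = (i == k) by rewrite -val_eqE /=; lia.
    by case: (i == k) => /=; ring.
  rewrite -val_eqE /= => ne; rewrite (_ : _ && _ = false); last lia.
  by rewrite subr0 mul0r.
have i1 : (i.+1 < p.*2)%N by have := ltn_ord i; lia.
rewrite (bigD1 (Ordinal i1)) //= big1 => [|j]; rewrite !mxE /= ?i_even /=.
  rewrite eqxx.
  have -> : (~~ odd k && (i.+1 == k.+1)) = (i == k) by rewrite -val_eqE /=; lia.
  by case: (i == k) => /=; ring.
rewrite -val_eqE /= => ne; rewrite (_ : ~~ odd j && _ = false); last lia.
by rewrite (_ : _ == _ = false) ?subr0 ?mul0r //; lia.
Qed.

End ComplexStructure.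

(** * Coordinates on R e_1 + k_1 + R e_{2n} *)

Section Coordinates.
Variables (R : realType) (m : nat).
Implicit Types (u v w : 'cV[R]_(1 + m + 1)).

Lemma coord_first_of x X y : coord_first (@gvec_of R m x X y) = x.
Proof. by rewrite /coord_first !col_mxKu mxE eqxx. Qed.
Lemma coord_k1_of x X y : coord_k1 (@gvec_of R m x X y) = X.
Proof. by rewrite /coord_k1 col_mxKu col_mxKd. Qed.
Lemma coord_last_of x X y : coord_last (@gvec_of R m x X y) = y.
Proof. by rewrite /coord_last col_mxKd mxE eqxx. Qed.
Definition coord_of := (coord_first_of, coord_k1_of, coord_last_of).

Lemma gvec_eta u : u = gvec_of (coord_first u) (coord_k1 u) (coord_last u).
Proof. by rewrite /gvec_of /coord_first /coord_last -!mx11_scalar !vsubmxK. Qed.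

Lemma inner_gvec u v : inner u v = coord_first u * coord_first v
  + inner (coord_k1 u) (coord_k1 v) + coord_last u * coord_last v.
Proof.
rewrite {1}(gvec_eta u) {1}(gvec_eta v) /inner /gvec_of !tr_col_mx !mul_row_col !tr_scalar_mx.
by rewrite !mul_scalar_mx !mxE eqxx !mulr1n.
Qed.

Lemma mem_nil_ideal u : coord_last u = 0 -> u \in nil_ideal R m.
Proof.
move=> u0; rewrite [u]matrix_sum_delta big_split_ord /=.
under eq_bigr do rewrite big_ord1.
rewrite [X in _ + X]big_ord1 big_ord1.
have -> : u (rshift (1 + m) 0) 0 = 0 by rewrite -u0 /coord_last mxE.
rewrite scale0r addr0; apply: rpred_sum => i _; apply/rpredZ/memv_span.
by apply/mapP; exists i; rewrite ?mem_enum.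
Qed.

(** An upper bound suffices: it is compared with the dimension of a subspace of the nilradical. *)
Lemma dim_nil_ideal : (\dim (nil_ideal R m) <= 1 + m)%N.
Proof. by apply: leq_trans (dim_span _) _; rewrite size_map -cardE card_ord. Qed.

End Coordinates.

(** * Signed sums over permutations and the wedge of two 2-forms *)

Section Alternating.
Variables (R : pzRingType).

(** Laplace expansion: a permutation amounts to the image j of the first index and a permutation of
    the others, and its sign is (-1)^j times that of the latter. Iteration makes a signed sum
    explicit. *)
Lemma sum_sign_perm n (F : 'S_n.+1 -> R) :
  \sum_(s : 'S_n.+1) (-1) ^+ s * F s =
  \sum_(j < n.+1) (-1) ^+ j * \sum_(s : 'S_n) (-1) ^+ s * F (lift_perm ord0 j s).
Proof.
pose h (js : 'I_n.+1 * 'S_n) := lift_perm ord0 js.1 js.2.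
have h_inj : injective h.
  move=> [j s] [j' s']; rewrite /h /= => /permP eq_h.
  have:= eq_h ord0; rewrite !lift_perm_id => eqj; subst j'; congr (_, _).
  by apply/permP => k; have:= eq_h (lift ord0 k); rewrite !lift_perm_lift => /lift_inj.
(* Since (n+1)! = (n+1) n!, injectivity of [h] is enough for bijectivity. *)
have card_h : (#|{: 'S_n.+1}| <= #|{: 'I_n.+1 * 'S_n}|)%N.
  by rewrite card_prod card_ord !card_Sn factS.
rewrite (reindex h) /=; last exact/onW_bij/inj_card_bij.
under [RHS]eq_bigr do rewrite big_distrr.
rewrite pair_bigA; apply: eq_bigr => -[j s] _ /=.
by rewrite odd_lift_perm signr_addb signr_odd mulrA.
Qed.
End Alternating.


(** By skew-symmetry the 24 permutations give six groups of four equal terms, and the factor 1/(2!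
    2!) leaves one term per (2,2)-shuffle. The vectors are indexed by [nat] so that their indices
    become numerals. *)
Lemma wedge22 (K : numFieldType) (V : Type)
    (alpha beta : V -> V -> K) (x : nat -> V) :
    (forall u v, alpha u v = - alpha v u) ->
    (forall u v, beta u v = - beta v u) ->
  wedge (fun Y : 'I_2 -> V => alpha (Y ord0) (Y ord_max))
    (fun Y : 'I_2 -> V => beta (Y ord0) (Y ord_max)) (fun i => x i) =
  alpha (x 0) (x 1) * beta (x 2) (x 3) - alpha (x 0) (x 2) * beta (x 1) (x 3)
  + alpha (x 0) (x 3) * beta (x 1) (x 2) + alpha (x 1) (x 2) * beta (x 0) (x 3)
  - alpha (x 1) (x 3) * beta (x 0) (x 2) + alpha (x 2) (x 3) * beta (x 0) (x 1).
Proof.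
move=> alphaN betaN; rewrite /wedge.
under eq_bigr do rewrite -mulrA.
have e1 : lshift 2 (ord_max : 'I_2) = lift ord0 ord0 :> 'I_(2 + 2) by apply: val_inj.
have e2 : rshift 2 (ord0 : 'I_2) = lift ord0 (lift ord0 ord0) :> 'I_(2 + 2).
  exact: val_inj.
have e3 : rshift 2 (ord_max : 'I_2) = lift ord0 (lift ord0 (lift ord0 ord0)) :> 'I_(2 + 2).
  exact: val_inj.
have e0 : lshift 2 (ord0 : 'I_2) = ord0 :> 'I_(2 + 2) by apply: val_inj.
rewrite sum_sign_perm e0 e1 e2 e3.
under eq_bigr => i _.
  under eq_bigr do rewrite !lift_perm_lift lift_perm_id.
  rewrite sum_sign_perm.
  under eq_bigr => j _.
    under eq_bigr do rewrite !lift_perm_lift lift_perm_id.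
    rewrite sum_sign_perm.
    under eq_bigr => k _.
      under eq_bigr do rewrite !lift_perm_lift lift_perm_id.
      rewrite sum_sign_perm big_ord1.
      (* After four expansions only the empty permutation is left. *)
      rewrite (big_pred1 1%g) => [|s]; last by apply/esym/eqP/permP => -[].
      rewrite odd_perm1 lift_perm_id.
    over.
  over.
over.
rewrite !big_ord_recl !big_ord0 /= /bump /= !(addn0, add0n, add1n).
(* Putting the arguments of every factor in increasing order makes equal terms match. *)
rewrite (_ : 2`! * 2`! = 4)%N // (alphaN (x 1) (x 0)) (alphaN (x 2) (x 0)) (alphaN (x 2) (x 1))
  (alphaN (x 3) (x 0)) (alphaN (x 3) (x 1)) (alphaN (x 3) (x 2)).
rewrite (betaN (x 1) (x 0)) (betaN (x 2) (x 0)) (betaN (x 2) (x 1))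
  (betaN (x 3) (x 0)) (betaN (x 3) (x 1)) (betaN (x 3) (x 2)).
by field.
Qed.

(** * Sums over subsets, one index at a time *)

Section SetCons.

(** The set analogue of consing a bit onto a list: it lets the sums over S and T in [type_part]
    unfold into explicit terms. *)
Definition set_cons n (b : bool) (S : {set 'I_n}) : {set 'I_n.+1} :=
  [set i | if unlift ord0 i is Some j then j \in S else b].

Lemma in_set_cons0 n b (S : {set 'I_n}) : (ord0 \in set_cons n b S) = b.
Proof. by rewrite inE unlift_none. Qed.

Lemma in_set_cons_lift n b (S : {set 'I_n}) i : (lift ord0 i \in set_cons n b S) = (i \in S).
Proof. by rewrite inE liftK. Qed.

Lemma card_set_cons n b (S : {set 'I_n}) : #|set_cons n b S| = (b + #|S|)%N.
Proof.
rewrite -!sum1_card big_mkcond big_ord_recl in_set_cons0; congr addn.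
by rewrite [RHS]big_mkcond; apply: eq_bigr => i _; rewrite in_set_cons_lift.
Qed.

Lemma sum_set_cons (V : nmodType) n (F : {set 'I_n.+1} -> V) :
  \sum_S F S = \sum_b \sum_S F (set_cons n b S).
Proof.
pose h (p : bool * {set 'I_n}) := set_cons n p.1 p.2.
have h_inj : injective h.
  move=> [b S] [b' S'] /setP /= eq_h; congr (_, _).
    by have:= eq_h ord0; rewrite !in_set_cons0.
  by apply/setP => k; have:= eq_h (lift ord0 k); rewrite !in_set_cons_lift.
have card_h : (#|{set 'I_n.+1}| <= #|{: bool * {set 'I_n}}|)%N.
  have cardS k : #|{set 'I_k}| = (2 ^ k)%N.
    by rewrite -cardsT -powersetT card_powerset cardsT card_ord.
  by rewrite card_prod card_bool !cardS expnS.
rewrite (reindex h) /=; last exact/onW_bij/inj_card_bij.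
by rewrite pair_bigA.
Qed.

Lemma sum_set_ord0 (V : nmodType) (F : {set 'I_0} -> V) : \sum_S F S = F set0.
Proof.
by rewrite (big_pred1 set0) // => S; apply/esym/eqP/setP => -[].
Qed.

End SetCons.

(** * Components of type (p, q) of 2-forms and 3-forms *)

Section TypePart.
Variables (R : rcfType) (V : Type) (J : V -> V).
Local Open Scope complex_scope.
Let sqr_iC : 'i%C * 'i%C = -1 :> R[i].
Proof. by rewrite -expr2 sqr_i. Qed.

(** A J-invariant 2-form has type (1,1). Since [V] carries no linear structure and [J] is any map,
    the rule for moving [J] across is assumed along with invariance; together they reduce all terms
    to a(x, y) and a(J x, y). *)
Lemma type_part2 (a : V -> V -> R[i]) p (X : 'I_2 -> V) :
  (forall u v, a (J u) (J v) = a u v) ->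
  (forall u v, a u (J v) = - a (J u) v) ->
  type_part J p (fun Y : 'I_2 -> V => a (Y ord0) (Y ord_max)) X =
  (p == 1)%:R * a (X ord0) (X ord_max).
Proof.
move=> aJJ aJ; rewrite /type_part.
have -> : ord_max = lift ord0 ord0 :> 'I_2 by apply: val_inj.
rewrite big_mkcond !sum_set_cons /=.
under eq_bigr => b _.
  rewrite sum_set_cons.
  under eq_bigr => b1 _.
    rewrite sum_set_ord0 !card_set_cons cards0 sum_set_cons.
    under eq_bigr => d _.
      rewrite sum_set_cons.
      under eq_bigr => d1 _.
        rewrite sum_set_ord0 big_mkcond !big_ord_recl big_ord0.
        rewrite !(in_set_cons_lift, in_set_cons0).
      over.
    over.
  over.
over.
rewrite !big_bool /= aJJ aJ.
set x := a _ _; set y := a _ _.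
by case: p => [|[|[|p]]] /=; field: sqr_iC.
Qed.


(** The types are (1,2) for [c] false and (2,1) for [c] true. For each set T of arguments hit by
    [J], the weight is the sum over the three admissible S of the products of factors 'i and - 'i:
    it is 3, 1 for |T| = 0, 2, and up to the sign of 'i it is 'i, 3 'i for |T| = 1, 3. *)
Lemma type_part3 (a : V -> V -> V -> R[i]) (c : bool) (X : 'I_3 -> V) :
  let x := X ord0 in let y := X (lift ord0 ord0) in let z := X ord_max in
  type_part J c.+1 (fun Y : 'I_3 -> V => a (Y ord0) (Y (lift ord0 ord0)) (Y ord_max)) X =
  8^-1 * (3 * a x y z + a x (J y) (J z) + a (J x) y (J z) + a (J x) (J y) z
   + (-1) ^+ c * 'i%C * (a (J x) y z + a x (J y) z + a x y (J z) + 3 * a (J x) (J y) (J z))).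
Proof.
rewrite /type_part /=.
have -> : ord_max = lift ord0 (lift ord0 ord0) :> 'I_3 by apply: val_inj.
rewrite big_mkcond sum_set_cons /=.
under eq_bigr => b _.
  rewrite sum_set_cons.
  under eq_bigr => b1 _.
   rewrite sum_set_cons.
   under eq_bigr => b2 _.
    rewrite sum_set_ord0 !card_set_cons cards0 sum_set_cons.
    under eq_bigr => d _.
      rewrite sum_set_cons.
      under eq_bigr => d1 _.
       rewrite sum_set_cons.
       under eq_bigr => d2 _.
        rewrite sum_set_ord0 big_mkcond !big_ord_recl big_ord0.
        rewrite !(in_set_cons_lift, in_set_cons0).
       over.
      over.
    over.
   over.
  over.
over.
rewrite !big_bool.
by case: c => /=; field: sqr_iC.
Qed.
End TypePart.

(** * The Chevalley-Eilenberg differential in degrees 2 and 3 *)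

Section LowDegree.
Variables (V : Type) (br : V -> V -> V).

Lemma ce_d2 (K : pzRingType) (a : V -> V -> K) (X : 'I_3 -> V) :
  let x := X ord0 in let y := X (lift ord0 ord0) in let z := X ord_max in
  ce_d br (fun Y : 'I_2 -> V => a (Y ord0) (Y ord_max)) X =
  - a (br x y) z + a (br x z) y - a (br y z) x.
Proof.
rewrite /ce_d /=.
have -> : ord_max = lift ord0 (lift ord0 ord0) :> 'I_3 by apply: val_inj.
under eq_bigr do rewrite big_mkcond.
rewrite !big_ord_recl !big_ord0 /= /ce_args /= /bump /= !(addn0, add0n, add1n).
have -> : inord 0 = ord0 :> 'I_3 by apply: val_inj; rewrite /= inordK.
have -> : inord 1 = lift ord0 ord0 :> 'I_3 by apply: val_inj; rewrite /= inordK.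
have -> : inord 2 = lift ord0 (lift ord0 ord0) :> 'I_3 by apply: val_inj; rewrite /= inordK.
by rewrite !exprS expr0 !(mulr1, mulN1r, mulrN1, opprK, mul1r, add0r, addr0).
Qed.

Lemma ce_d3 (K : pzRingType) (a : V -> V -> V -> K) (X : 'I_4 -> V) :
  let x := X ord0 in let y := X (lift ord0 ord0) in
  let z := X (lift ord0 (lift ord0 ord0)) in let t := X ord_max in
  ce_d br (fun Y : 'I_3 -> V => a (Y ord0) (Y (lift ord0 ord0)) (Y ord_max)) X =
  - a (br x y) z t + a (br x z) y t - a (br x t) y z
  - a (br y z) x t + a (br y t) x z - a (br z t) x y.
Proof.
rewrite /ce_d /=.
have -> : ord_max = lift ord0 (lift ord0 (lift ord0 ord0)) :> 'I_4 by apply: val_inj.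
under eq_bigr do rewrite big_mkcond.
rewrite !big_ord_recl !big_ord0 /= /ce_args /= /bump /= !(addn0, add0n, add1n).
have -> : inord 0 = ord0 :> 'I_4 by apply: val_inj; rewrite /= inordK.
have -> : inord 1 = lift ord0 ord0 :> 'I_4 by apply: val_inj; rewrite /= inordK.
have -> : inord 2 = lift ord0 (lift ord0 ord0) :> 'I_4 by apply: val_inj; rewrite /= inordK.
have -> : inord 3 = lift ord0 (lift ord0 (lift ord0 ord0)) :> 'I_4.
  by apply: val_inj; rewrite /= inordK.
by rewrite !exprS expr0 !(mulr1, mulN1r, mulrN1, opprK, mul1r, add0r, addr0) !addrA.
Qed.

Lemma ce_d_form0 (K : pzRingType) k : ce_d br (fun _ : 'I_k -> V => 0 : K) = fun=> 0.
Proof.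
by apply/funext => X; rewrite /ce_d; apply: big1 => i _; apply: big1 => j _; rewrite mulr0.
Qed.

Lemma type_part_form0 (R : rcfType) (J : V -> V) k p X :
  type_part J p (fun _ : 'I_k -> V => 0 : R[i]) X = 0.
Proof. by rewrite /type_part; apply: big1 => S _; apply: big1 => T _; rewrite mulr0. Qed.

End LowDegree.

(** * The operator d^c on real forms of type (1,1) *)

Section Dc.
Variables (R : rcfType) (V : Type) (br : V -> V -> V) (J : V -> V).
Variables (w : V -> V -> R) (dw : V -> V -> V -> R).
Hypotheses (wJJ : forall u v, w (J u) (J v) = w u v)
  (wJ : forall u v, w u (J v) = - w (J u) v)
  (dwE : forall x y z, - w (br x y) z + w (br x z) y - w (br y z) x = dw x y z)
  (dwJ : forall x y z, dw (J x) y z + dw x (J y) z + dw x y (J z) = dw (J x) (J y) (J z)).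

(* [dwJ] says that dw has no component of type (3,0) or (0,3). *)
Lemma dc_type11 (X : 'I_3 -> V) :
  dc br J (fun Y : 'I_2 -> V => (w (Y ord0) (Y ord_max))%:C%C) X =
  (- dw (J (X ord0)) (J (X (lift ord0 ord0))) (J (X ord_max)))%:C%C.
Proof.
have tp p : type_part J p (fun Y : 'I_2 -> V => (w (Y ord0) (Y ord_max))%:C%C)
    = fun Y => (p == 1)%:R * (w (Y ord0) (Y ord_max))%:C%C.
  apply/funext => Y.
  rewrite (type_part2 _ _ J (fun u v => (w u v)%:C%C)) // => u v; first by rewrite wJJ.
  by rewrite wJ rmorphN.
have d0 : ce_d br (fun Y : 'I_2 -> V => 0 * (w (Y ord0) (Y ord_max))%:C%C) = fun=> 0.
  by rewrite -(ce_d_form0 V br R[i] 2); congr ce_d; apply/funext => Y; rewrite mul0r.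
have d1 : ce_d br (fun Y : 'I_2 -> V => 1 * (w (Y ord0) (Y ord_max))%:C%C)
   = fun Y => (dw (Y ord0) (Y (lift ord0 ord0)) (Y ord_max))%:C%C.
  apply/funext => Y; rewrite (ce_d2 V br R[i] (fun u v => 1 * (w u v)%:C%C)) /= !mul1r.
  by rewrite -dwE rmorphB rmorphD rmorphN.
(* Only p = 1 contributes: [del] keeps the (2,1)-part of dw and [delbar] its (1,2)-part. *)
rewrite /dc /del /delbar !big_ord_recl !big_ord0 !tp /= d0 d1 !type_part_form0.
rewrite !(add0r, addr0).
rewrite /bump /= !(addn0, add1n).
rewrite (type_part3 _ _ J (fun x y z => (dw x y z)%:C%C) false).
rewrite (type_part3 _ _ J (fun x y z => (dw x y z)%:C%C) true).
(* In the difference of the two parts the terms without and with two [J] cancel. By [dwJ] the rest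
   adds up to 'i times dw(J, J, J), and the outer factor 'i gives the sign. *)
rewrite -dwJ rmorphN !rmorphD.
have := sqr_i R; rewrite expr2 => ii.
by field: ii.
Qed.

End Dc.

(** With both factors equal to eta the six shuffle terms agree in pairs, so the wedge is twice the
    left-hand side of this Plücker relation. *)
Lemma form0_wedge (R : realType) m (eta : 'M[R]_m) : eta^T = - eta ->
  form0 (wedge (form2_mx eta) (form2_mx eta)) <->
  forall X Y Z T, form_mx eta X Y * form_mx eta Z T
    - form_mx eta X Z * form_mx eta Y T + form_mx eta X T * form_mx eta Y Z = 0.
Proof.
move=> eta_skew.
have etaN := form_mx_skew _ _ _ eta_skew.
split=> [eta2 X Y Z T|eta2 X].
  have := eta2 (fun i : 'I_4 => nth X [:: X; Y; Z; T] i).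
  rewrite (wedge22 R _ _ _ (nth X [:: X; Y; Z; T]) etaN etaN) /= => eta20.
  by lra.
(* [inord] supplies the family indexed by [nat] that [wedge22] expects. *)
have -> : X = fun i => X (inord i) by apply/funext => i; rewrite inord_val.
rewrite (wedge22 R _ _ _ (fun k => X (inord k)) etaN etaN).
have := eta2 (X (inord 0)) (X (inord 1)) (X (inord 2)) (X (inord 3)).
by lra.
Qed.

(** * The forms d omega and d^c omega on mu(0, 0, A, eta) *)

Section Forms.
Variables (R : realType) (p : nat) (A eta : 'M[R]_p.*2).
Local Notation m := p.*2.
Local Notation J := (Jk1_mx R m).
Hypothesis eta_skew : eta^T = - eta.
Hypothesis A_eta : A^T *m eta + eta *m A = 0.

(** As J e_1 = e_{2n}, the k_1-component of integrability at (e_1, Y) reads A J Y = J A Y; its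
    e_1-component at two vectors of k_1 is the J-invariance of eta. *)
Lemma integrable_mu : integrable (mu A eta) (@Jg R m) ->
  A *m J = J *m A /\ J^T *m eta *m J = eta.
Proof.
have coord_k1B u v : coord_k1 (u - v) = coord_k1 u - coord_k1 v :> 'cV[R]_m.
  by rewrite /coord_k1 !linearB.
have coord_firstB u v : @coord_first R m (u - v) = coord_first u - coord_first v.
  by rewrite /coord_first !linearB !mxE.
move=> int; split; apply: form_mx_inj => X Y.
  have /(congr1 (@coord_k1 _ _)) := int (gvec_of 1 0 0) (gvec_of 0 Y 0).
  rewrite !coord_k1B /mu /Jg !coord_of /Jk1 !(scale1r, scale0r, mulmx0, subr0, oppr0).
  have -> : coord_k1 0 = 0 :> 'cV[R]_m by rewrite /coord_k1 !linear0.
  move/eqP; rewrite subr_eq0 => /eqP AJY.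
  by rewrite -[A *m J]mul1mx -[J *m A]mul1mx -!form_mxMr -!mulmxA AJY.
have /(congr1 (@coord_first _ _)) := int (gvec_of 0 X 0) (gvec_of 0 Y 0).
rewrite !coord_firstB /mu /Jg !coord_of /Jk1 !(oppr0, subr0, opprK).
have -> : @coord_first R m 0 = 0 by rewrite /coord_first !mxE.
by rewrite form_mxMl form_mxMr; lra.
Qed.

Hypothesis AJ : A *m J = J *m A.
Hypothesis eta_J : J^T *m eta *m J = eta.

(** The matrix K of kappa; by [tr_AJ] it equals eta + J (A^T + A). In the present form it is visibly
    skew, each of the last two summands being minus the transpose of the other. *)
Definition torsion_mx := eta + A^T *m J + J *m A.

Local Notation K := torsion_mx.
Local Notation ka u v := (form_mx K (coord_k1 u) (coord_k1 v)).

Lemma tr_AJ : A^T *m J = J *m A^T.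
Proof. by apply: trmx_inj; rewrite !trmx_mul trmxK tr_Jk1_mx mulNmx mulmxN AJ. Qed.

Lemma torsion_skew : K^T = - K.
Proof.
rewrite /K !linearD /= !trmx_mul trmxK eta_skew tr_Jk1_mx mulNmx mulmxN -!addrA.
by congr (_ + _); rewrite addrC.
Qed.

Lemma torsion_J : K *m J = J *m K.
Proof.
have JJ : J *m J = - 1%:M by exact: Jk1_mx_sqr.
(* Since J^T = - J and J^2 = - 1, invariance of eta means commuting with J. *)
have eJ : eta *m J = J *m eta.
  rewrite -{2}eta_J tr_Jk1_mx !mulNmx mulmxN !mulmxA JJ !mulNmx mul1mx opprK //.
by rewrite /K !mulmxDl !mulmxDr eJ tr_AJ -!mulmxA tr_AJ AJ.
Qed.

Lemma form_torsionN X Y : form_mx K X Y = - form_mx K Y X.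
Proof. exact/form_mx_skew/torsion_skew. Qed.

Lemma form_torsionJ X Y : form_mx K X (J *m Y) = - form_mx K (J *m X) Y.
Proof. by rewrite form_mxMl form_mxMr tr_Jk1_mx torsion_J mulNmx form_mxN opprK. Qed.

Lemma form_torsionJJ X Y : form_mx K (J *m X) (J *m Y) = form_mx K X Y.
Proof. by rewrite form_torsionJ mulmxA Jk1_mx_sqr mulNmx mul1mx form_mxNl opprK. Qed.

Definition omega (u v : 'cV[R]_(1 + m + 1)) := inner (Jg u) v.

Lemma omegaE u v : omega u v = - coord_last u * coord_first v
  + form_mx (- J) (coord_k1 u) (coord_k1 v) + coord_first u * coord_last v.
Proof.
by rewrite /omega inner_gvec !coord_of inner_form_mx /Jk1 form_mxMl mulmx1 tr_Jk1_mx.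
Qed.

Lemma omega_JJ u v : omega (Jg u) (Jg v) = omega u v.
Proof.
rewrite !omegaE /Jg !coord_of form_mxMl form_mxMr mulmxN mulNmx tr_Jk1_mx !mulNmx opprK.
by rewrite Jk1_mx_sqr mulNmx mul1mx; ring.
Qed.

Lemma omega_J u v : omega u (Jg v) = - omega (Jg u) v.
Proof.
rewrite !omegaE /Jg !coord_of form_mxMl form_mxMr mulmxN mulNmx tr_Jk1_mx !mulNmx opprK.
by rewrite Jk1_mx_sqr opprK !form_mxN; ring.
Qed.

Lemma d_omega x y z :
  - omega (mu A eta x y) z + omega (mu A eta x z) y - omega (mu A eta y z) x =
  coord_last x * ka y z - coord_last y * ka x z + coord_last z * ka x y.
Proof.
(* On k_1 this is omega(A X, Y) - omega(A Y, X) = eta(X, Y) - kappa(X, Y). The eta here cancels the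
   one from [X, Y] = - eta(X, Y) e_1. *)
have ND X Y : form_mx (- J) (A *m X) Y =
    form_mx (- J) (A *m Y) X + form_mx eta X Y - form_mx K X Y.
  have -> : form_mx (- J) (A *m Y) X = form_mx (J *m A) X Y.
    by rewrite form_mxMl -[LHS]form_mx_tr trmx_mul trmxK linearN /= tr_Jk1_mx opprK.
  by rewrite form_mxMl mulmxN form_mxN !form_mxD; ring.
rewrite !omegaE !coord_of !form_mxDl !form_mxNl !form_mxZl.
rewrite (ND (coord_k1 x) (coord_k1 y)) (ND (coord_k1 x) (coord_k1 z))
  (ND (coord_k1 y) (coord_k1 z)).
ring.
Qed.

Definition d_omega_form (x y z : 'cV[R]_(1 + m + 1)) :=
  coord_last x * ka y z - coord_last y * ka x z + coord_last z * ka x y.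

Definition dc_omega_form (x y z : 'cV[R]_(1 + m + 1)) :=
  - (coord_first x * ka y z - coord_first y * ka x z + coord_first z * ka x y).

(** [dc_type11] gives - d omega(J, J, J); here e^{2n} composed with J is e^1, and kappa is
    J-invariant. *)
Lemma dc_omega (X : 'I_3 -> 'cV[R]_(1 + m + 1)) :
  dc (mu A eta) (@Jg R m)
    (fun Y : 'I_2 -> _ => (fundamental_form (@Jg R m) (@inner R _) Y)%:C%C) X =
  (dc_omega_form (X ord0) (X (lift ord0 ord0)) (X ord_max))%:C%C.
Proof.
rewrite -[LHS]/(dc (mu A eta) (@Jg R m)
  (fun Y : 'I_2 -> _ => (omega (Y ord0) (Y ord_max))%:C%C) X).
rewrite (dc_type11 _ _ (mu A eta) _ _ d_omega_form omega_JJ omega_J d_omega).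
  by rewrite /d_omega_form /dc_omega_form !coord_of !form_torsionJJ.
(* The type condition: kappa(J Y, Z) + kappa(Y, J Z) = 0, so only [J] in the slot of e^{2n}
   survives. *)
move=> x y z; rewrite /d_omega_form !coord_of !form_torsionJJ !form_torsionJ; ring.
Qed.

(** d^c omega takes real values and R embeds in R[i], so the condition becomes a real identity. *)
Lemma skt_mu : skt (mu A eta) (@Jg R m) (@inner R _) <-> forall x y z t,
  let F := dc_omega_form in let br := mu A eta in
  - F (br x y) z t + F (br x z) y t - F (br x t) y z
  - F (br y z) x t + F (br y t) x z - F (br z t) x y = 0.
Proof.
rewrite /skt (funext dc_omega).
have dF (X : 'I_4 -> 'cV[R]_(1 + m + 1)) := ce_d3 _ (mu A eta) R[i]
  (fun x y z => (dc_omega_form x y z)%:C%C) X.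
have realE (a b c d e f : R) : - a%:C%C + b%:C%C - c%:C%C - d%:C%C + e%:C%C - f%:C%C
    = (- a + b - c - d + e - f)%:C%C by rewrite !(rmorphB, rmorphD, rmorphN).
split=> [skt x y z t|skt X].
  have := skt (fun i : 'I_4 => nth x [:: x; y; z; t] i).
  by rewrite dF realE => /eqP; rewrite fmorph_eq0 => /eqP.
by rewrite dF realE skt rmorph0.
Qed.

End Forms.

(** * The Kähler and SKT conditions *)

Section Metric.
Variables (R : realType) (p : nat) (A eta : 'M[R]_p.*2).
Local Notation m := p.*2.
Local Notation J := (Jk1_mx R m).
Hypothesis eta_skew : eta^T = - eta.
Hypothesis A_eta : A^T *m eta + eta *m A = 0.
Hypothesis AJ : A *m J = J *m A.
Hypothesis eta_J : J^T *m eta *m J = eta.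

Local Notation K := (torsion_mx _ _ A eta).

Lemma in_u_k1P : in_u_k1 A <-> A^T = - A.
Proof.
split=> [[_ A_skew]|A_skew].
  apply: form_mx_inj => X Y; rewrite -[A^T]mulmx1 -form_mxMl -inner_form_mx.
  by rewrite A_skew inner_form_mx form_mxMr mul1mx form_mxN.
split=> [X|X Y]; first by rewrite /Jk1 !mulmxA AJ.
by rewrite !inner_form_mx form_mxMl form_mxMr mulmx1 mul1mx A_skew form_mxN.
Qed.

(* With S = A + A^T the hypothesis becomes A^T S + S A = 0, whose trace is
   \tr (S S). *)
Lemma skew_of_torsion : A^T *m K + K *m A = 0 -> A^T = - A.
Proof.
pose S := A + A^T => AK.
have eqS : A^T *m S + S *m A = 0.
  (* K = eta + J S and A^T eta + eta A = 0 leave only the J S part of the hypothesis; [J] is then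
     cancelled by J^2 = - 1. *)
  have JS : J *m (A^T *m S + S *m A) = 0.
    rewrite -AK (_ : K = eta + J *m S).
      rewrite [in RHS]mulmxDr [in RHS]mulmxDl addrACA A_eta add0r.
      by rewrite !mulmxA (tr_AJ _ _ _ AJ) mulmxDr !mulmxA.
    by rewrite /torsion_mx -addrA (tr_AJ _ _ _ AJ) -mulmxDr [_ + A]addrC.
  by rewrite -[LHS]mul1mx -[1%:M]opprK -Jk1_mx_sqr mulNmx -mulmxA JS mulmx0 oppr0.
apply/eqP; rewrite -subr_eq0 opprK addrC; apply/eqP/sym_mx_eq0.
  by rewrite linearD /= trmxK addrC.
by rewrite -/S {1}/S mulmxDl linearD /= [\tr (A *m S)]mxtrace_mulC addrC -linearD eqS linear0.
Qed.

Lemma torsion_of_skew : A^T = - A -> K = eta.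
Proof. by move=> A_skew; rewrite /torsion_mx A_skew mulNmx AJ -addrA addNr addr0. Qed.

Lemma not_kahler : eta <> 0 -> ~ kahler (mu A eta) (@Jg R m) (@inner R _).
Proof.
move=> eta_neq0 kahler; apply: eta_neq0.
have K0 : K = 0.
  apply: form_mx_inj => Y Z.
  (* At (e_{2n}, Y, Z) the form e^{2n} /\ kappa has value kappa(Y, Z). *)
  have := kahler (fun i : 'I_3 => nth 0 [:: gvec_of 0 0 1; gvec_of 0 Y 0; gvec_of 0 Z 0] i).
  rewrite -[X in X = 0 -> _]/(ce_d (mu A eta)
    (fun Y : 'I_2 -> _ => omega R p (Y ord0) (Y ord_max)) _).
  rewrite ce_d2 d_omega !coord_of !mul0r mul1r subr0 addr0 => ->.
  by rewrite form_0mx.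
rewrite -(torsion_of_skew _) //; apply: skew_of_torsion.
by rewrite K0 mulmx0 mul0mx addr0.
Qed.

Lemma skt_skew : skt (mu A eta) (@Jg R m) (@inner R _) -> A^T = - A.
Proof.
move=> /(skt_mu _ _ _ _ AJ eta_J) skt; apply: skew_of_torsion.
apply: form_mx_inj => Y Z.
(* At (e_{2n}, Y, Z, e_1) only the brackets A Y and A Z contribute, and kappa(A Y, Z) + kappa(Y, A
   Z) is left. *)
have := skt (gvec_of 0 0 1) (gvec_of 0 Y 0) (gvec_of 0 Z 0) (gvec_of 1 0 0).
rewrite /dc_omega_form /mu /= !coord_of !(scale0r, scale1r, mulmx0, subr0, scaler0).
rewrite !(form_mx0l, form_mx0r) [form_mx (_ + _ *m A) _ _]form_mxD -form_mxMl -form_mxMr.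
rewrite form_0mx (form_torsionN _ _ _ _ eta_skew (A *m Z)); lra.
Qed.

Lemma sktP : skt (mu A eta) (@Jg R m) (@inner R _) <->
  in_u_k1 A /\ form0 (wedge (form2_mx eta) (form2_mx eta)).
Proof.
rewrite in_u_k1P form0_wedge //.
have etaN := form_mx_skew _ _ _ eta_skew.
have etaA X Y : form_mx eta (A *m X) Y = form_mx eta (A *m Y) X.
  rewrite [RHS]etaN form_mxMl form_mxMr; apply/eqP; rewrite -subr_eq0 opprK.
  by rewrite -form_mxD A_eta form_0mx.
split=> [skt|[A_skew eta2]].
  have A_skew := skt_skew skt; split=> // X Y Z T.
  move/(skt_mu _ _ _ _ AJ eta_J): skt.
  (* Brackets of vectors of k_1 lie in R e_1, so only products of values of eta remain. *)
  move=> /(_ (gvec_of 0 X 0) (gvec_of 0 Y 0) (gvec_of 0 Z 0) (gvec_of 0 T 0)).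
  rewrite /dc_omega_form /mu /= (torsion_of_skew A_skew) !coord_of => H.
  by lra.
apply/(skt_mu _ _ _ _ AJ eta_J) => x y z t.
rewrite /dc_omega_form /mu /= (torsion_of_skew A_skew) !coord_of.
rewrite !(form_mxDl, form_mxNl, form_mxZl).
have := eta2 (coord_k1 x) (coord_k1 y) (coord_k1 z) (coord_k1 t).
rewrite (etaA (coord_k1 y) (coord_k1 x)) (etaA (coord_k1 z) (coord_k1 x))
  (etaA (coord_k1 t) (coord_k1 x)).
(* With [etaA] in a fixed order all terms containing A cancel, leaving a multiple of the Plücker
   relation. *)
rewrite (etaA (coord_k1 z) (coord_k1 y)) (etaA (coord_k1 t) (coord_k1 y))
  (etaA (coord_k1 t) (coord_k1 z)).
by lra.
Qed.

End Metric.

(** * Decomposable eta and the isomorphism type of the nilradical *)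

Lemma kernel_basis (F : fieldType) r m k (N : 'M[F]_(r, m)) :
    row_free N -> m = (r + k)%N ->
  exists (P : 'M[F]_(m, k)) (Q : 'M[F]_(k, m)), N *m P = 0 /\ Q *m P = 1%:M.
Proof.
move=> N_free mE.
have kE : \rank (kermx N^T) = k.
  by rewrite mxrank_ker mxrank_tr (eqP N_free) mE addKn.
(* [k] is replaced by the rank because [row_base] has that many rows by its type. The transposes
   below turn the left kernel of N^T into the right kernel of N, with a left inverse witnessing
   independence. *)
move: k kE {mE} => _ <-.
have /row_freeP[Q BQ] := row_base_free (kermx N^T).
exists (row_base (kermx N^T))^T, Q^T; split; apply: trmx_inj.
  rewrite trmx_mul trmxK trmx0; apply/sub_kermxP.
  by rewrite eq_row_base.
by rewrite trmx_mul !trmxK trmx1.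
Qed.

Section Nilradical.
Variables (R : realType) (m k : nat) (A eta : 'M[R]_m).

(** Pulled back along [f], the bracket is a 2 x 2 determinant times a fixed vector, so eta is a
    multiple of the wedge of two covectors. *)
Lemma decomposable_of_lie_iso :
    lie_iso_sub (mu A eta) (@h3_sum_br R k) (nil_ideal R m) ->
  forall X Y Z T, form_mx eta X Y * form_mx eta Z T
    - form_mx eta X Z * form_mx eta Y T + form_mx eta X T * form_mx eta Y Z = 0.
Proof.
move=> [f [_ f_im f_br]] X Y Z T.
have preim W : exists u, f u = gvec_of 0 W 0.
  have : gvec_of 0 W 0 \in limg f by rewrite f_im mem_nil_ideal ?coord_last_of.
  by case/memv_imgP => u _ ->; exists u.
(* The e_1-coordinate of the image of the central generator of h_3. *)
pose c := coord_first (f (col_mx (delta_mx ord_max 0) 0)).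
have etaE u v U W : f u = gvec_of 0 U 0 -> f v = gvec_of 0 W 0 ->
    form_mx eta U W =
    - c * (usubmx u 0 0 * usubmx v 1 0 - usubmx u 1 0 * usubmx v 0 0).
  move=> fu fv; have := congr1 (@coord_first _ _) (f_br u v).
  rewrite fu fv /mu !coord_of.
  have -> : h3_sum_br u v = (usubmx u 0 0 * usubmx v 1 0 - usubmx u 1 0 * usubmx v 0 0)
      *: col_mx (delta_mx ord_max 0) 0.
    by rewrite scale_col_mx scaler0.
  rewrite linearZ /= /coord_first !linearZ /= mxE => E.
  by rewrite /c /coord_first mulNr mulrC E opprK.
have [x fx] := preim X; have [y fy] := preim Y.
have [z fz] := preim Z; have [t ft] := preim T.
rewrite (etaE x y) // (etaE z t) // (etaE x z) // (etaE y t) // (etaE x t) // (etaE y z) //.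
ring.
Qed.

Lemma lie_iso_of_decomposable : m = k.+2 -> eta^T = - eta -> eta <> 0 ->
    (forall X Y Z T, form_mx eta X Y * form_mx eta Z T
    - form_mx eta X Z * form_mx eta Y T + form_mx eta X T * form_mx eta Y Z = 0) ->
  lie_iso_sub (mu A eta) (@h3_sum_br R k) (nil_ideal R m).
Proof.
move=> mE eta_skew eta_neq0 eta2.
have etaN := form_mx_skew _ _ _ eta_skew.
have eta_diag X : form_mx eta X X = 0 by have := etaN X X; lra.
have [a [b eta_ab]] : exists a b, form_mx eta a b = 1.
  have [a [b ab]] : exists a b, form_mx eta a b != 0.
    apply: contrapT => H; apply: eta_neq0; apply: form_mx_inj => X Y.
    rewrite form_0mx; apply: contrapT => /eqP XY; apply: H.
    by exists X, Y.
  by exists ((form_mx eta a b)^-1 *: a), b; rewrite form_mxZl mulVf.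
have etaE Z W : form_mx eta Z W =
    form_mx eta a Z * form_mx eta b W - form_mx eta a W * form_mx eta b Z.
  by have := eta2 a b Z W; rewrite eta_ab; lra.
(* The rows are eta(a, .) and eta(b, .), so by [etaE] the kernel of [N] is that of eta. *)
pose N := col_mx (a^T *m eta) (b^T *m eta).
have N_free : row_free N.
  (* The right inverse has columns b and - a, as eta(a, b) = 1 and eta vanishes on the diagonal. *)
  apply/row_freeP; exists (row_mx b (- a)).
  rewrite mul_col_mx !mul_mx_row [1%:M]scalar_mx_block.
  have mx11 X Y : X^T *m eta *m Y = (form_mx eta X Y)%:M by rewrite -mx11_scalar.
  by rewrite /block_mx !mx11 !form_mxNr eta_ab !eta_diag (etaN b a) eta_ab opprK oppr0 !raddf0.
have [P [Q [NP QP]]] := kernel_basis _ _ _ k _ N_free mE.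
have [aP bP] : a^T *m eta *m P = 0 /\ b^T *m eta *m P = 0.
  by apply: eq_col_mx; rewrite -mul_col_mx NP col_mx0.
pose L : 'M[R]_(m, 3) := a *m delta_mx 0 0 + b *m delta_mx 0 1.
(* The generators of h_3 go to a, b and [a, b] = - e_1, and R^k goes to the kernel of eta. *)
pose G : 'M[R]_(1 + m + 1, 3 + k) :=
  col_mx (col_mx (row_mx (- delta_mx 0 ord_max) 0) (row_mx L P)) 0.
pose f : 'Hom('cV[R]_(3 + k), gvec R m) := linfun (mulmx G).
pose h (u : 'cV[R]_(3 + k)) := usubmx u 0 0 *: a + usubmx u 1 0 *: b + P *m dsubmx u.
have fE u : f u = gvec_of (- usubmx u ord_max 0) (h u) 0.
  rewrite lfunE /= -{1}[u]vsubmxK /G !mul_col_mx !mul_row_col !mul0mx addr0.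
  rewrite mulNmx -rowE /L mulmxDl -!mulmxA -!rowE /gvec_of raddf0.
  congr (col_mx (col_mx _ _) _).
    by apply/matrixP => i j; rewrite !ord1 !mxE eqxx.
  by rewrite /h; congr (_ + _ + _); apply/matrixP => i j;
    rewrite !ord1 !mxE big_ord1 !mxE mulrC.
have etaP X u : X^T *m eta *m P = 0 -> form_mx eta X (P *m u) = 0.
  by move=> XP; rewrite /form_mx mulmxA XP mul0mx mxE.
(* Pairing with a and b recovers the first two coordinates, which serves both injectivity and the
   bracket. *)
have ah u : form_mx eta a (h u) = usubmx u 1 0.
  by rewrite !form_mxDr !form_mxZr eta_ab eta_diag etaP //; ring.
have bh u : form_mx eta b (h u) = - usubmx u 0 0.
  by rewrite !form_mxDr !form_mxZr (etaN b a) eta_ab eta_diag etaP //; ring.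
have kerf : lker f = 0%VS.
  apply/eqP; rewrite -subv0; apply/subvP => u; rewrite memv_ker memv0 fE => /eqP fu0.
  have /eqP u2 : coord_first (f u) = 0 by rewrite fE fu0 /coord_first !mxE.
  have hu : h u = 0.
    by have := congr1 (@coord_k1 _ _) fu0; rewrite coord_of /coord_k1 !linear0.
  have u1 := ah u; have u0 := bh u; rewrite hu !form_mx0r in u1 u0.
  rewrite fE coord_of oppr_eq0 in u2.
  have u0' : usubmx u 0 0 == 0 by rewrite -oppr_eq0 -u0.
  have uu : usubmx u = 0.
    apply/matrixP => i j; rewrite ord1 [RHS]mxE.
    case: i => -[|[|[|//]]] i3.
    - by rewrite (_ : Ordinal i3 = 0) ?(eqP u0'); last exact: val_inj.
    - by rewrite (_ : Ordinal i3 = 1) -?u1 //; apply: val_inj.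
    - by rewrite (_ : Ordinal i3 = ord_max) ?(eqP u2); last exact: val_inj.
  have du : dsubmx u = 0.
    rewrite -[LHS]mul1mx -QP -mulmxA; move: hu; rewrite /h uu !mxE !scale0r !add0r => ->.
    by rewrite mulmx0.
  by rewrite -[u]vsubmxK uu du col_mx0.
exists f; split=> // [|u v].
  (* By injectivity the image has dimension 3 + k = 1 + m, at least that of the nilradical
     containing it. *)
  apply/eqP; rewrite eqEdim; apply/andP; split.
    apply/subvP => _ /memv_imgP[u _ ->]; apply: mem_nil_ideal.
    by rewrite fE coord_of.
  rewrite limg_dim_eq ?kerf ?capv0 // dimvf.
  apply: leq_trans (dim_nil_ideal _ _) _; rewrite mE dim_matrix; lia.
rewrite !fE /mu !coord_of !scale0r subrr etaE !ah !bh; congr gvec_of.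
  by rewrite /h3_sum_br /h3_br !col_mxKu !mxE /=; ring.
rewrite /h /h3_sum_br /h3_br !col_mxKu col_mxKd !mxE /=.
by rewrite !mulr0 !scale0r mulmx0 !addr0.
Qed.

End Nilradical.

Theorem proposition4p3 (R : realType) (n : nat) (hn : (2 <= n)%N)
  (A eta : 'M[R]_(n.-1.*2))
  (eta_skew : eta^T = - eta) (eta_neq0 : eta <> 0)
  (A_eta : forall X Y, form_mx eta (A *m X) Y + form_mx eta X (A *m Y) = 0)
  (hermitian : integrable (mu A eta) (@Jg R (n.-1.*2)))
  (unimodular : strongly_unimodular (mu A eta)) :
  [/\ ~ kahler (mu A eta) (@Jg R (n.-1.*2)) (@inner R _),
      skt (mu A eta) (@Jg R (n.-1.*2)) (@inner R _) <->
        in_u_k1 A /\ form0 (wedge (form2_mx eta) (form2_mx eta)) &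
      form0 (wedge (form2_mx eta) (form2_mx eta)) <->
        lie_iso_sub (mu A eta) (@h3_sum_br R ((n - 2).*2))
          (nil_ideal R (n.-1.*2))].
Proof.
have A_eta_mx : A^T *m eta + eta *m A = 0.
  by apply: form_mx_inj => X Y; rewrite form_mxD -form_mxMl -form_mxMr A_eta form_0mx.
have [AJ eta_J] := integrable_mu _ _ _ _ hermitian.
split.
- exact: not_kahler.
- exact: sktP.
rewrite form0_wedge //; split=> [eta2|]; last exact: decomposable_of_lie_iso.
(* The arithmetic is 2(n - 1) = 2(n - 2) + 2, where truncated subtraction requires n >= 2. *)
by apply: lie_iso_of_decomposable => //; lia.
Qed.
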